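(* Let $A_1,\dots,A_4,B_1,\dots,B_4\subseteq\mathbf{Z}_{145}$ be the explicit subsets defined in the context. Then the two $580\times 580$ matrices $GS([A_1],[A_2],[A_3],[A_4])$ and $GS([B_1],[B_2],[B_3],[B_4])$, obtained by substituting the circulant matrices $[A_i]$, respectively $[B_i]$, for $P_i$ in the Goethals--Seidel array, are skew-Hadamard matrices of order $580$.
   Context: A Hadamard matrix of order $m$ is an $m\times m$ matrix $A$ with entries in $\{1,-1\}$ such that $AA^T=mI_m$, where $T$ denotes the transpose and $I_m$ the identity matrix. A skew-Hadamard matrix is a Hadamard matrix $A$ such that $A-I_m$ is skew-symmetric. $\mathbf{Z}_n$ denotes the ring of integers modulo $n$, and $\mathbf{Z}_n^*$ its group of invertible elements. For $X\subseteq\mathbf{Z}_n$ let $a_X=(a_0,a_1,\dots,a_{n-1})$ be the $\{\pm1\}$-row vector with $a_i=-1$ if and only if $i\in X$; $[X]$ denotes the $n\times n$ circulant matrix with first row $a_X$ (i.e. its $(i,j)$ entry is $a_{j-i \bmod n}$). $R$ denotes the $n\times n$ matrix with ones on the back-diagonal and all other entries zero. For $n\times n$ matrices $P_1,P_2,P_3,P_4$ the Goethals--Seidel array is the $4n\times 4n$ matrix $$GS(P_1,P_2,P_3,P_4)=\left[\begin{array}{cccc} P_1 & P_2R & P_3R & P_4R\\ -P_2R & P_1 & -P_4^TR & P_3^TR\\ -P_3R & P_4^TR & P_1 & -P_2^TR\\ -P_4R & -P_3^TR & P_2^TR & P_1\end{array}\right].$$ Let $n=145$ and let $H=\{1,16,36,81,111,136,141\}$,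 the subgroup of order $7$ of $\mathbf{Z}_{145}^*$, acting on $\mathbf{Z}_{145}$ by multiplication. Its $24$ nonzero orbits $\alpha_0,\dots,\alpha_{23}$ are enumerated as follows: $\alpha_0=H$, $\alpha_2=\{2,17,32,72,77,127,137\}$, $\alpha_4=\{3,43,48,98,108,118,133\}$, $\alpha_6=\{6,51,71,86,91,96,121\}$, $\alpha_8=\{7,52,82,107,112,117,132\}$, $\alpha_{10}=\{11,21,31,46,61,101,106\}$, $\alpha_{12}=\{14,19,69,79,89,104,119\}$, $\alpha_{14}=\{22,42,57,62,67,92,122\}$, $\alpha_{16}=\{5,35,80,100,115,120,125\}$, $\alpha_{18}=\{10,15,55,70,85,95,105\}$, $\alpha_{20}=\{29\}$, $\alpha_{22}=\{58\}$, and $\alpha_{2i+1}=-\alpha_{2i}$ (mod $145$) for $0\le i\le 11$. For $k=1,2,3,4$ set $A_k=\bigcup_{i\in J_k}\alpha_i$ and $B_k=\bigcup_{i\in L_k}\alpha_i$, where $J_1=\{1,2,4,7,9,10,13,14,16,19,20,22\}$, $J_2=\{0,2,4,7,10,11,14,18,19,20,21,22\}$, $J_3=\{1,3,6,9,12,13,14,17,19,20,21,22,23\}$, $J_4=\{2,3,5,6,7,9,12,13,15,16,19,20,21,22,23\}$, $L_1=\{1,3,5,7,8,10,13,15,17,18,20,23\}$, $L_2=\{0,1,2,4,12,13,15,18,19,20,22,23\}$, $L_3=\{4,5,6,7,9,12,14,16,18,20,21,22,23\}$, $L_4=\{2,6,9,10,11,12,13,14,15,17,18,20,21,22,23\}$.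 *)

(* Defs.v *)
From mathcomp Require Import all_boot all_order all_algebra.

Set Implicit Arguments.
Unset Strict Implicit.
Unset Printing Implicit Defensive.

Import GRing.Theory.
Local Open Scope ring_scope.

Definition hadamard (m : nat) (A : 'M[int]_m) : Prop :=
  (forall i j, A i j = 1 \/ A i j = -1) /\ A *m A^T = (m%:R)%:M.

Definition skew_symmetric (m : nat) (A : 'M[int]_m) : Prop := A^T = - A.

Definition skew_hadamard (m : nat) (A : 'M[int]_m) : Prop :=
  hadamard A /\ skew_symmetric (A - 1%:M).

(* The additive group Z/(n+1) is represented by 'I_n.+1; 'Z_n.+2 is convertible
   to 'I_n.+2, so subsets of 'Z_145 can be used with n := 144. *)
Definition sign_row (n : nat) (X : {set 'I_n.+1}) : 'rV[int]_n.+1 :=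
  \row_i (if i \in X then -1 else 1).

(* The subtraction j - i is the one of the group 'I_n.+1, i.e. modulo n+1. *)
Definition circulant (n : nat) (a : 'rV[int]_n.+1) : 'M[int]_n.+1 :=
  \matrix_(i, j) a 0 (j - i).

Definition set_circulant (n : nat) (X : {set 'I_n.+1}) : 'M[int]_n.+1 :=
  circulant (sign_row X).

Definition back_diag (n : nat) : 'M[int]_n :=
  \matrix_(i, j) (j == rev_ord i)%:R.

Definition goethals_seidel (n : nat) (P1 P2 P3 P4 : 'M[int]_n) :
    'M[int]_(n + n + (n + n)) :=
  let R := back_diag n in
  block_mx
    (block_mx     P1              (P2 *m R)
              (- (P2 *m R))        P1)
    (block_mx    (P3 *m R)        (P4 *m R)
              (- (P4^T *m R))     (P3^T *m R))
    (block_mx (- (P3 *m R))       (P4^T *m R)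
              (- (P4 *m R))    (- (P3^T *m R)))
    (block_mx     P1           (- (P2^T *m R))
                 (P2^T *m R)       P1).

(* Entry i lists the least nonnegative residues of the orbit alpha_(2i) of the
   subgroup H = {1, 16, 36, 81, 111, 136, 141} of the units modulo 145. *)
Definition even_orbits : seq (seq nat) :=
  [:: [:: 1; 16; 36; 81; 111; 136; 141];
      [:: 2; 17; 32; 72; 77; 127; 137];
      [:: 3; 43; 48; 98; 108; 118; 133];
      [:: 6; 51; 71; 86; 91; 96; 121];
      [:: 7; 52; 82; 107; 112; 117; 132];
      [:: 11; 21; 31; 46; 61; 101; 106];
      [:: 14; 19; 69; 79; 89; 104; 119];
      [:: 22; 42; 57; 62; 67; 92; 122];
      [:: 5; 35; 80; 100; 115; 120; 125];
      [:: 10; 15; 55; 70; 85; 95; 105];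
      [:: 29];
      [:: 58] ]%N.

Definition even_orbit (i : nat) : {set 'Z_145} :=
  [set x : 'Z_145 | (x : nat) \in nth [::] even_orbits i].

Definition alpha (i : nat) : {set 'Z_145} :=
  if odd i then [set - x | x in even_orbit i./2] else even_orbit i./2.

Definition orbit_union (J : seq nat) : {set 'Z_145} :=
  \bigcup_(i <- J) alpha i.

Definition A1 := orbit_union [:: 1; 2; 4; 7; 9; 10; 13; 14; 16; 19; 20; 22]%N.
Definition A2 := orbit_union [:: 0; 2; 4; 7; 10; 11; 14; 18; 19; 20; 21; 22]%N.
Definition A3 :=
  orbit_union [:: 1; 3; 6; 9; 12; 13; 14; 17; 19; 20; 21; 22; 23]%N.
Definition A4 :=
  orbit_union [:: 2; 3; 5; 6; 7; 9; 12; 13; 15; 16; 19; 20; 21; 22; 23]%N.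

Definition B1 := orbit_union [:: 1; 3; 5; 7; 8; 10; 13; 15; 17; 18; 20; 23]%N.
Definition B2 := orbit_union [:: 0; 1; 2; 4; 12; 13; 15; 18; 19; 20; 22; 23]%N.
Definition B3 :=
  orbit_union [:: 4; 5; 6; 7; 9; 12; 14; 16; 18; 20; 21; 22; 23]%N.
Definition B4 :=
  orbit_union [:: 2; 6; 9; 10; 11; 12; 13; 14; 15; 17; 18; 20; 21; 22; 23]%N.

(* Main.v *)
Require Import Defs.
From mathcomp Require Import all_boot all_order all_algebra.
From mathcomp Require Import ring zify.

(** Circulant matrices of a given order commute with each other and with their
    transposes, and the reversal R satisfies R^2 = 1 and R C = C^T R for every
    circulant C, because each C R is symmetric.  These rules alone reduce the
    Gram matrix of a Goethals-Seidel array of circulants P1, ..., P4 to a block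
    diagonal matrix with all diagonal blocks equal to the sum of the Pi Pi^T
    ([goethals_seidel_gram]): in the off-diagonal blocks the terms cancel in
    pairs.  They also show that the array minus 1 is skew as soon as P1 - 1 is
    ([goethals_seidel_skew]), because the off-diagonal blocks are paired off with
    opposite signs, as symmetric matrices C R.

    What remains concerns the four sets.  Entry (i, j) of Pi Pi^T is the
    periodic autocorrelation of the i-th sign row at shift i - j, that is N - 2h
    where N is the order and h the number of disagreements between the row and
    its rotation.  So the four autocorrelations cancel at every nonzero shift if
    and only if the disagreements add up to 2N ([table_skew_hadamard]).  For
    N = 145 the orbit unions are tabulated as lists of 145 booleans, and the 144
    shifts, together with the skewness of the first row, are checked by
    evaluation. *)

Set Implicit Arguments.
Unset Strict Implicit.
Unset Printing Implicit Defensive.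

Import GRing.Theory.
Local Open Scope ring_scope.

(** * Circulants and the reversal *)

Lemma tr_circulant n (a : 'rV[int]_n.+1) :
  (circulant a)^T = circulant (\row_i a 0 (- i)).
Proof. by apply/matrixP => i j; rewrite !mxE opprB. Qed.

Lemma circulant_comm n (a b : 'rV[int]_n.+1) :
  circulant a *m circulant b = circulant b *m circulant a.
Proof.
apply/matrixP => i j; rewrite !mxE.
(* The reflection k |-> i + j - k exchanges the offsets k - i and j - k. *)
rewrite (reindex_inj (h := fun k => i + j - k)) /=; last first.
  by move=> k l /addrI/oppr_inj.
apply: eq_bigr => k _; rewrite !mxE mulrC.
have -> : i + j - k - i = j - k by rewrite addrAC [i + j]addrC addrK.
by have -> : j - (i + j - k) = k - i by rewrite opprB addrC opprD addrA subrK.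
Qed.

Lemma rev_ordE n (i : 'I_n.+1) : rev_ord i = ord_max - i.
Proof.
apply: (addIr i); rewrite subrK; apply: val_inj => /=.
by rewrite subSS subnK ?modn_small // -ltnS ltn_ord.
Qed.

Lemma mul_back_diagE n (P : 'M[int]_n) i j :
  (P *m back_diag n) i j = P i (rev_ord j).
Proof.
rewrite mxE (bigD1 (rev_ord j)) //= mxE rev_ordK eqxx mulr1 big1 ?addr0 // => k.
by rewrite mxE -(inj_eq rev_ord_inj) rev_ordK eq_sym => /negPf ->; rewrite mulr0.
Qed.

Lemma tr_back_diag n : (back_diag n)^T = back_diag n.
Proof.
by apply/matrixP => i j; rewrite !mxE -(inj_eq rev_ord_inj) rev_ordK eq_sym.
Qed.

Lemma back_diagK n : back_diag n *m back_diag n = 1%:M.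
Proof.
by apply/matrixP => i j; rewrite mul_back_diagE !mxE (inj_eq rev_ord_inj) eq_sym.
Qed.

(** The entries depend on i + j only. *)
Lemma circulant_back_diag_sym n (a : 'rV[int]_n.+1) :
  (circulant a *m back_diag n.+1)^T = circulant a *m back_diag n.+1.
Proof.
apply/matrixP => i j; rewrite mxE !mul_back_diagE !mxE !rev_ordE.
by rewrite addrAC.
Qed.

Lemma back_diag_circulant n (a : 'rV[int]_n.+1) :
  back_diag n.+1 *m circulant a = (circulant a)^T *m back_diag n.+1.
Proof.
rewrite tr_circulant -circulant_back_diag_sym -tr_circulant.
by rewrite trmx_mul trmxK tr_back_diag.
Qed.

(** * The Goethals-Seidel array of circulants *)

(** The instance of [raddfN] for transposition: rewriting with the generic lemma
    is very slow on block matrices. *)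
Lemma trmx_opp m n (A : 'M[int]_(m, n)) : (- A)^T = - A^T.
Proof. exact: raddfN. Qed.

(** Every block of the product is a signed sum of terms X Y or X Y R, with X and
    Y circulant, once R has been moved to the right across circulants.  Ordering
    the commuting factors then makes the cancellation a matter of addition. *)
Lemma goethals_seidel_gram n (a b c d : 'rV[int]_n.+1) (m : int) :
  let P1 := circulant a in let P2 := circulant b in
  let P3 := circulant c in let P4 := circulant d in
  P1 *m P1^T + P2 *m P2^T + P3 *m P3^T + P4 *m P4^T = m%:M ->
  goethals_seidel P1 P2 P3 P4 *m (goethals_seidel P1 P2 P3 P4)^T = m%:M.
Proof.
move=> P1 P2 P3 P4 gram.
rewrite /goethals_seidel; set R := back_diag _.
have RR : R *m R = 1%:M := back_diagK _.
have symR x : (circulant x *m R)^T = circulant x *m R :=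
  circulant_back_diag_sym x.
have symRt x : ((circulant x)^T *m R)^T = (circulant x)^T *m R.
  by rewrite tr_circulant symR.
have RC x : R *m circulant x = (circulant x)^T *m R := back_diag_circulant x.
have RCt x : R *m (circulant x)^T = circulant x *m R.
  by rewrite -[in RHS](trmxK (circulant x)) tr_circulant RC.
have C (x y : 'rV_n.+1) :
    circulant x *m circulant y = circulant y *m circulant x :=
  circulant_comm x y.
have Ct (x y : 'rV_n.+1) :
    circulant x *m (circulant y)^T = (circulant y)^T *m circulant x.
  by rewrite tr_circulant C.
have Ctt (x y : 'rV_n.+1) :
    (circulant x)^T *m (circulant y)^T = (circulant y)^T *m (circulant x)^T.
  by rewrite !tr_circulant C.
rewrite !tr_block_mx !mulmx_block !add_block_mx !trmx_opp !symR !symRt.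
rewrite [m%:M]scalar_mx_block !(@scalar_mx_block _ n.+1 n.+1) -gram.
have mulRR x y : x *m R *m (circulant y *m R) = x *m (circulant y)^T.
  by rewrite mulmxA -(mulmxA x) RC -!mulmxA RR mulmx1.
have mulRtR x y : x *m R *m ((circulant y)^T *m R) = x *m circulant y.
  by rewrite tr_circulant mulRR -tr_circulant trmxK.
have mulRt x y : x *m R *m (circulant y)^T = x *m circulant y *m R.
  by rewrite -mulmxA RCt mulmxA.
rewrite !(mulNmx, mulmxN) ?opprK.
rewrite /P1 /P2 /P3 /P4 !(mulRR, mulRtR, mulRt) ?mulmxA.
(* The commutation rules are instantiated so that rewriting terminates: indices
   increase, and transposes come last. *)
rewrite !(C b a, C c a, C d a, C c b, C d b, C d c).
rewrite -!Ct ?(Ctt b a, Ctt c a, Ctt d a, Ctt c b, Ctt d b, Ctt d c).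
(* The zero blocks of the outer level are split to match the inner level; the
   products are then atoms of an additive identity. *)
by congr block_mx; rewrite -?[RHS]block_mx0; congr block_mx;
  repeat match goal with |- context [?X *m ?Y] => generalize (X *m Y) => ? end;
  apply/matrixP => i j; rewrite !mxE; ring.
Qed.

Lemma goethals_seidel_skew n (a b c d : 'rV[int]_n.+1) :
  skew_symmetric (circulant a - 1%:M) ->
  skew_symmetric
    (goethals_seidel (circulant a) (circulant b) (circulant c) (circulant d)
      - 1%:M).
Proof.
rewrite /skew_symmetric /goethals_seidel => skew_a.
have symRt (x : 'rV_n.+1) :
    ((circulant x)^T *m back_diag n.+1)^T = (circulant x)^T *m back_diag n.+1.
  by rewrite tr_circulant circulant_back_diag_sym.
have {}skew_a : (circulant a)^T = 1%:M + 1%:M - circulant a.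
  move/eqP: skew_a; rewrite raddfB /= trmx1 subr_eq => /eqP ->.
  by rewrite opprB addrAC.
rewrite !(@scalar_mx_block _ (_ + _)) !(@scalar_mx_block _ n.+1 n.+1).
rewrite !opp_block_mx !add_block_mx.
rewrite !oppr0 !addr0 !tr_block_mx !linearD /= !trmx_opp !trmx1.
rewrite !circulant_back_diag_sym !symRt skew_a !opp_block_mx !opprK.
have -> : 1%:M + 1%:M - circulant a - 1%:M = - (circulant a - 1%:M).
  by rewrite opprB [LHS]addrAC addrK.
by [].
Qed.

Definition sign_mx m n (A : 'M[int]_(m, n)) :=
  forall i j, A i j = 1 \/ A i j = -1.

Lemma sign_mx_opp m n (A : 'M[int]_(m, n)) : sign_mx A -> sign_mx (- A).
Proof. by move=> sA i j; rewrite mxE; case: (sA i j) => ->; [right|left]. Qed.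

Lemma sign_mx_tr m n (A : 'M[int]_(m, n)) : sign_mx A -> sign_mx A^T.
Proof. by move=> sA i j; rewrite mxE. Qed.

Lemma sign_mx_back_diag n (A : 'M[int]_n) :
  sign_mx A -> sign_mx (A *m back_diag n).
Proof. by move=> sA i j; rewrite mul_back_diagE. Qed.

Lemma sign_mx_block m1 m2 n1 n2 (A : 'M[int]_(m1, n1)) (B : 'M_(m1, n2))
    (C : 'M_(m2, n1)) (D : 'M_(m2, n2)) :
  sign_mx A -> sign_mx B -> sign_mx C -> sign_mx D ->
  sign_mx (block_mx A B C D).
Proof.
by move=> sA sB sC sD i j; rewrite !mxE; case: split => k; rewrite mxE;
  case: split.
Qed.

Lemma goethals_seidel_sign n (P1 P2 P3 P4 : 'M[int]_n) :
  sign_mx P1 -> sign_mx P2 -> sign_mx P3 -> sign_mx P4 ->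
  sign_mx (goethals_seidel P1 P2 P3 P4).
Proof.
by move=> *; do ![apply: sign_mx_block | apply: sign_mx_opp
  | apply: sign_mx_back_diag | apply: sign_mx_tr | done].
Qed.

Lemma set_circulant_sign n (X : {set 'I_n.+1}) : sign_mx (set_circulant X).
Proof. by move=> i j; rewrite !mxE; case: ifP; [right | left]. Qed.

Lemma circulant_gramE n (a : 'rV[int]_n.+1) i j :
  (circulant a *m (circulant a)^T) i j = \sum_k a 0 k * a 0 (k + (i - j)).
Proof.
rewrite mxE (reindex_inj (addIr i)) /=; apply: eq_bigr => k _.
by rewrite !mxE addrK addrA.
Qed.

(** * Sets given by boolean tables *)

Definition hamming (s t : seq bool) : nat :=
  count (fun p => p.1 != p.2) (zip s t).

Definition table_set n (s : seq bool) : {set 'I_n.+1} :=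
  [set x : 'I_n.+1 | nth false s x].

Lemma nth_rot (T : Type) (x0 : T) (s : seq T) d k :
  (d < size s)%N -> (k < size s)%N ->
  nth x0 (rot d s) k = nth x0 s ((k + d) %% size s).
Proof.
move=> lt_d lt_k; rewrite /rot nth_cat size_drop nth_drop.
case: ltnP => [lt|le].
  by rewrite modn_small addnC //; lia.
rewrite nth_take; last by lia.
congr nth; rewrite -(subnK (_ : size s <= k + d)%N) ?modnDr ?modn_small; lia.
Qed.

(** A product of two signs is 1 if they agree and -1 otherwise, hence 1 minus
    twice the indicator of a disagreement. *)
Lemma table_autocorrelation n (s : seq bool) (d : 'I_n.+1) :
  size s = n.+1 ->
  \sum_k sign_row (table_set n s) 0 k * sign_row (table_set n s) 0 (k + d)
    = n.+1%:R - (hamming s (rot d s)).*2%:R.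
Proof.
move=> size_s.
have -> : hamming s (rot d s)
    = (\sum_(k < n.+1) (nth false s k != nth false s (k + d)%R))%N.
  rewrite /hamming -sum1_count big_mkcond (big_nth (false, false)) size_zip.
  rewrite size_rot minnn size_s big_mkord; apply: eq_bigr => k _.
  by rewrite nth_zip ?size_rot //= nth_rot ?size_s ?ltn_ord //.
have <- : \sum_(k < n.+1) (1 : int) = n.+1%:R by rewrite sumr_const card_ord.
rewrite -muln2 natrM natr_sum mulr_suml -sumrB; apply: eq_bigr => k _.
rewrite !mxE !inE.
by do 2!case: (nth _ _ _).
Qed.

(** Negation modulo n.+1 fixes 0 and reverses the positions 1, ..., n: this says
    that 0 is outside the set and that, for each other x, exactly one of x and
    - x is inside. *)
Definition skew_table (s : seq bool) :=
  s == false :: map negb (rev (behead s)).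

Lemma skew_table_circulant n (s : seq bool) :
  size s = n.+1 -> skew_table s ->
  skew_symmetric (set_circulant (table_set n s) - 1%:M).
Proof.
move=> size_s skew_s; apply/matrixP => i j; rewrite !mxE !inE (eq_sym i).
rewrite -subr_eq0 -[i - j]opprB; move: (j - i) => k.
have [-> | k_neq0] := eqVneq k 0.
  by rewrite oppr0 (eqP skew_s).
have -> : nth false s (- k)%R = ~~ nth false s k.
  move: skew_s size_s; rewrite /skew_table; case: s => // b t.
  case/eqP => _ def_t [size_t].
  have := ltn_ord k; have : (0 < k)%N by rewrite lt0n.
  (* Position l.+1 of the table is position l of its tail t. *)
  rewrite [val (- k)]/=; case: (val k) => // l _ lt_ln.
  rewrite modn_small subSS ?ltnS ?leq_subr // -subnSK //= [t in RHS]def_t.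
  by rewrite (nth_map false) ?size_rev ?size_t // nth_rev ?size_t ?negbK.
by case: (nth _ _ _).
Qed.

(** The supplementary difference set condition: at a shift d, the sum of the
    four autocorrelations is 4 n.+1 minus twice the sum of the distances, so it
    vanishes when this sum is 2 n.+1. *)
Definition complementary_tables (ts : seq (seq bool)) n :=
  all (fun d => sumn [seq hamming s (rot d s) | s <- ts] == n.+1.*2) (iota 1 n).

Lemma table_skew_hadamard n (s1 s2 s3 s4 : seq bool) :
  all (fun s => size s == n.+1) [:: s1; s2; s3; s4] ->
  skew_table s1 -> complementary_tables [:: s1; s2; s3; s4] n ->
  skew_hadamard
    (goethals_seidel
      (set_circulant (table_set n s1)) (set_circulant (table_set n s2))
      (set_circulant (table_set n s3)) (set_circulant (table_set n s4))).
Proof.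
case/and5P => /eqP z1 /eqP z2 /eqP z3 /eqP z4 _ skew1 compl.
split; last exact/goethals_seidel_skew/skew_table_circulant.
split; first by apply: goethals_seidel_sign; apply: set_circulant_sign.
apply: goethals_seidel_gram; apply/matrixP => i j.
rewrite mxE [X in X + _]mxE [X in X + _ + _]mxE !circulant_gramE.
rewrite !table_autocorrelation // mxE.
have [<-|neq_ij] := eqVneq i j.
  rewrite subrr !rot0.
  have h0 s : hamming s s = 0%N.
    by rewrite /hamming; elim: s => //= b s ->; rewrite eqxx.
  by rewrite !h0 !subr0 mulr1n -!natrD addnA.
have /allP/(_ (i - j : 'I_n.+1)) := compl.
rewrite mem_iota add1n ltn_ord andbT lt0n -[X in X != _]/(val (i - j)).
have -> : val (i - j) != 0%N.
  by rewrite -[0%N]/(val (0 : 'I_n.+1)) val_eqE subr_eq0.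
move=> /(_ isT) /eqP /= sum_h.
lia.
Qed.

(** * The orbit unions modulo 145 *)

(** Membership in an orbit, computed on residues: sets over a finite type do not
    evaluate, whereas this does. *)
Definition mem_alpha (i x : nat) : bool :=
  (if odd i then (145 - x) %% 145 else x)%N \in nth [::] even_orbits i./2.

Definition orbit_table (J : seq nat) : seq bool :=
  mkseq (fun x => has (mem_alpha^~ x) J) 145.

Lemma in_alpha i (x : 'Z_145) : (x \in alpha i) = mem_alpha i x.
Proof.
rewrite /alpha /mem_alpha; case: odd; last by rewrite inE.
by rewrite -[x in LHS]opprK mem_imset ?inE //; apply: oppr_inj.
Qed.

Lemma orbit_unionE J : orbit_union J = table_set 144 (orbit_table J).
Proof.
apply/setP => x; rewrite inE nth_mkseq // /orbit_union.
by elim: J => [|i J IH]; rewrite ?big_nil ?inE // big_cons inE IH in_alpha.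
Qed.

Theorem proposition3p2 :
  @skew_hadamard 580
    (@goethals_seidel 145 (set_circulant A1) (set_circulant A2)
                          (set_circulant A3) (set_circulant A4)) /\
  @skew_hadamard 580
    (@goethals_seidel 145 (set_circulant B1) (set_circulant B2)
                          (set_circulant B3) (set_circulant B4)).
Proof.
split.
- rewrite /A1 /A2 /A3 /A4 !orbit_unionE.
  by apply: (@table_skew_hadamard 144); vm_compute.
- rewrite /B1 /B2 /B3 /B4 !orbit_unionE.
  by apply: (@table_skew_hadamard 144); vm_compute.
Qed.
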